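(* Let $X$ be a Banach space. If $X$ does not have the L-Dunford-Pettis property, then $W(X,\ell^{\infty})$ is not complemented in $DPcc(X,\ell^{\infty})$.
   Context: $X'$ denotes the topological dual of the Banach space $X$; operators are bounded linear operators; $\ell^\infty$ is the Banach space of all bounded sequences. A norm bounded subset $A$ of $X$ is called Dunford-Pettis (DP) if every weakly null sequence $(f_n)$ in $X'$ satisfies $\lim_{n\to\infty}\sup_{x\in A}|f_n(x)|=0$. A sequence $(x_n)$ ''is a DP set'' if the set $\{x_n : n\in\mathbb{N}\}$ is a DP set. An operator $T:X\to Y$ between Banach spaces is Dunford-Pettis completely continuous (DPcc) if it maps every weakly null sequence in $X$ which is a DP set in $X$ to a norm null sequence in $Y$. $W(X,\ell^\infty)$ denotes the space of all weakly compact operators from $X$ into $\ell^\infty$ and $DPcc(X,\ell^\infty)$ the space of all Dunford-Pettis completely continuous operators from $X$ into $\ell^\infty$, both with the operator norm; every weakly compact operator is DPcc, so $W(X,\ell^\infty)\subseteq DPcc(X,\ell^\infty)$. A subspace $Z_1$ of a Banach space $Z$ is complemented in $Z$ if there exists a (bounded linear) projection from $Z$ onto $Z_1$. A norm bounded subset $A$ of $X'$ is called an L-Dunford-Pettis set if every weakly null sequence $(x_n)$ in $X$ which is a DP set in $X$ satisfies $\lim_{n\to\infty}\sup_{f\in A}|f(x_n)|=0$. A Banach space $X$ has the L-Dunford-Pettis property if every L-Dunford-Pettis set in $X'$ is relatively weakly compact. *)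

(* Defs.v *)
From HB Require Import structures.
From mathcomp Require Import all_boot all_order all_algebra.
From mathcomp Require Import all_classical all_reals.
From mathcomp Require Import topology normedtype sequences.

Set Implicit Arguments.
Unset Strict Implicit.
Unset Printing Implicit Defensive.

Import Order.TTheory GRing.Theory Num.Theory.
Import numFieldNormedType.Exports.

Local Open Scope classical_set_scope.
Local Open Scope ring_scope.

(* For linear maps, continuous = bounded (linear_bounded_continuous);
   opnormP below gives the explicit bound. *)
Section Operators.
Context {R : realType} (X Y : normedModType R).

Definition is_oper : {pred X -> Y} := [pred f | `[< linear f /\ continuous f >]].

Record oper := Oper { oper_fun :> X -> Y; _ : oper_fun \in is_oper }.

HB.instance Definition _ := [isSub for oper_fun].
HB.instance Definition _ := [Choice of oper by <:].

Lemma is_oper_submod : submod_closed is_oper.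
Proof.
split.
  apply/asboolP; split => [a x y /=|x]; first by rewrite scaler0 addr0.
  exact: cst_continuous.
move=> a f g /asboolP[lf cf] /asboolP[lg cg]; apply/asboolP; split.
  move=> b x y /=; rewrite !fctE lf lg !scalerDr !scalerA mulrC.
  by rewrite addrACA.
move=> x; apply: (@continuousD _ _ _ (fun z => a *: f z) g); last exact: cg.
by apply: continuousZl_tmp; exact: cf.
Qed.

HB.instance Definition _ := GRing.isSubmodClosed.Build _ _ is_oper is_oper_submod.
HB.instance Definition _ := [SubChoice_isSubLmodule of oper by <:].

Lemma oper_linear (f : oper) : linear f.
Proof. by case: f => f /= /asboolP[]. Qed.

HB.instance Definition _ (f : oper) :=
  GRing.isLinear.Build R X Y _ f (@oper_linear f).

Lemma oper_continuous (f : oper) : continuous f.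
Proof. by case: f => f /= /asboolP[]. Qed.

Definition opnorm (f : oper) : R := sup [set `|f x| | x in [set x | `|x| <= 1]].

Lemma oper_bounded (f : oper) : exists M, forall x, `|f x| <= M * `|x|.
Proof.
have /(@linear_boundedP _ _ _ f) : bounded_near f (nbhs (0 : X)).
  by apply/(@linear_bounded_continuous _ _ _ f); exact: oper_continuous.
by move=> [M [_ H]]; exists (M + 1); apply: H; rewrite ltrDl.
Qed.

Lemma opnorm_has_sup (f : oper) :
  has_sup [set `|f x| | x in [set x | `|x| <= 1]].
Proof.
split; first by exists `|f 0|, 0 => //=; rewrite normr0.
have [M HM] := oper_bounded f.
exists `|M| => _ [x /= x1 <-]; apply: (le_trans (HM x)).
apply: (@le_trans _ _ (`|M| * `|x|)); first by rewrite ler_wpM2r// ler_norm.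
by rewrite ler_piMr.
Qed.

Lemma opnorm_ub (f : oper) x : `|x| <= 1 -> `|f x| <= opnorm f.
Proof.
by move=> x1; apply: (sup_upper_bound (opnorm_has_sup f)); exists x.
Qed.

Lemma opnorm_le (f : oper) M : (forall x, `|x| <= 1 -> `|f x| <= M) ->
  opnorm f <= M.
Proof.
move=> H; apply: ge_sup; first by case: (opnorm_has_sup f).
by move=> _ [x /= x1 <-]; exact: H.
Qed.

Lemma opnorm_ge0 f : 0 <= opnorm f.
Proof. by apply: le_trans (@opnorm_ub f 0 _) => //; rewrite normr0. Qed.

Lemma opnormP (f : oper) x : `|f x| <= opnorm f * `|x|.
Proof.
have [->|x0] := eqVneq x 0; first by rewrite linear0 !normr0 mulr0.
have nx : 0 < `|x| by rewrite normr_gt0.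
have : `|f (`|x|^-1 *: x)| <= opnorm f by apply: opnorm_ub; rewrite normfZV.
by rewrite linearZ/= normrZ normfV normr_id ler_pdivrMl// mulrC.
Qed.

Lemma ler_opnormD f g : opnorm (f + g) <= opnorm f + opnorm g.
Proof.
apply: opnorm_le => x x1.
by apply: (le_trans (ler_normD _ _)); apply: lerD; exact: opnorm_ub.
Qed.

Lemma opnormZ (a : R) f : opnorm (a *: f) = `|a| * opnorm f.
Proof.
have le b h : opnorm (b *: h) <= `|b| * opnorm h.
  apply: opnorm_le => x x1; rewrite [X in `|X|](_ : _ = b *: h x)//.
  by rewrite normrZ ler_wpM2l// opnorm_ub.
apply/eqP; rewrite eq_le le/=.
have [->|a0] := eqVneq a 0; first by rewrite normr0 mul0r opnorm_ge0.
rewrite -ler_pdivlMl ?normr_gt0// -normfV.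
by apply: le_trans (le _ _); rewrite scalerA mulVf// scale1r.
Qed.

Lemma opnorm0_eq0 f : opnorm f = 0 -> f = 0.
Proof.
move=> f0; apply/val_inj/funext => x /=; apply/eqP.
by rewrite -normr_le0; apply: (le_trans (opnormP f x)); rewrite f0 mul0r.
Qed.

HB.instance Definition _ :=
  Lmodule_isNormed.Build R oper ler_opnormD opnormZ opnorm0_eq0.

End Operators.

Definition dual {R : realType} (X : normedModType R) := oper X R^o.
HB.instance Definition _ (R : realType) (X : normedModType R) :=
  NormedModule.on (dual X).

Section Linf.
Context (R : realType).

Definition is_linf : {pred nat -> R} :=
  [pred u | `[< exists M, forall n, `|u n| <= M >]].

Record linf := Linf { linf_seq :> nat -> R; _ : linf_seq \in is_linf }.

HB.instance Definition _ := [isSub for linf_seq].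
HB.instance Definition _ := [Choice of linf by <:].

Lemma is_linf_submod : @submod_closed R (nat -> R^o) is_linf.
Proof.
split; first by apply/asboolP; exists 0 => n; rewrite normr0.
move=> a u v /asboolP[M uM] /asboolP[N vN]; apply/asboolP.
exists (`|a| * M + N) => n /=; apply: (le_trans (ler_normD _ _)).
by apply: lerD => //; rewrite normrM ler_wpM2l.
Qed.

HB.instance Definition _ :=
  @GRing.isSubmodClosed.Build R (nat -> R^o) is_linf is_linf_submod.
HB.instance Definition _ :=
  @GRing.SubChoice_isSubLmodule.Build R (nat -> R^o) is_linf linf is_linf_submod.

Definition linf_norm (u : linf) : R := sup (range (fun n => `|u n|)).

Lemma linf_has_sup (u : linf) : has_sup (range (fun n => `|u n|)).
Proof.
split; first by exists `|u 0%N|, 0%N.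
by case: u => u /= /asboolP[M uM]; exists M => _ [n _ <-].
Qed.

Lemma linf_norm_ub (u : linf) n : `|u n| <= linf_norm u.
Proof. by apply: (sup_upper_bound (linf_has_sup u)); exists n. Qed.

Lemma linf_norm_le (u : linf) M : (forall n, `|u n| <= M) -> linf_norm u <= M.
Proof.
move=> H; apply: ge_sup; first by case: (linf_has_sup u).
by move=> _ [n _ <-]; exact: H.
Qed.

Lemma linf_norm_ge0 u : 0 <= linf_norm u.
Proof. exact: le_trans (linf_norm_ub u 0%N). Qed.

Lemma ler_linf_normD u v : linf_norm (u + v) <= linf_norm u + linf_norm v.
Proof.
apply: linf_norm_le => n.
by apply: (le_trans (ler_normD _ _)); apply: lerD; exact: linf_norm_ub.
Qed.

Lemma linf_normZ (a : R) u : linf_norm (a *: u) = `|a| * linf_norm u.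
Proof.
have le b v : linf_norm (b *: v) <= `|b| * linf_norm v.
  apply: linf_norm_le => n; rewrite [X in `|X|](_ : _ = b * v n)//.
  by rewrite normrM ler_wpM2l// linf_norm_ub.
apply/eqP; rewrite eq_le le/=.
have [->|a0] := eqVneq a 0; first by rewrite normr0 mul0r linf_norm_ge0.
rewrite -ler_pdivlMl ?normr_gt0// -normfV.
by apply: le_trans (le _ _); rewrite scalerA mulVf// scale1r.
Qed.

Lemma linf_norm0_eq0 u : linf_norm u = 0 -> u = 0.
Proof.
move=> u0; apply/val_inj/funext => n /=; apply/eqP.
by rewrite -normr_le0 -u0 linf_norm_ub.
Qed.

HB.instance Definition _ :=
  Lmodule_isNormed.Build R linf ler_linf_normD linf_normZ linf_norm0_eq0.

Lemma linf_coord_dist (u v : linf) n : `|u n - v n| <= `|u - v|.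
Proof. exact: (linf_norm_ub (u - v)). Qed.

Lemma linf_complete (F : set_system linf) : ProperFilter F -> cauchy F -> cvg F.
Proof.
move=> FF Fc.
have Fb e : 0 < e -> exists u : linf, F (ball u e).
  by move=> e0; have /cauchyP/(_ e e0) := Fc.
have Fn n : cvg ((fun u : linf => u n) @ F).
  apply: R_complete; apply/cauchyP => e /Fb [u Fu].
  exists (u n); change (F [set v : linf | ball (u n) e (v n)]).
  apply: filterS Fu => v; rewrite -!ball_normE/=.
  by apply: le_lt_trans; exact: linf_coord_dist.
pose l n : R := lim ((fun u : linf => u n) @ F).
have close (u : linf) e : F (ball u e) -> forall n, `|u n - l n| <= e.
  move=> Fu n; apply/ler_addgt0Pr => d d0.
  have Fd : F [set v : linf | ball (l n) d (v n)].
    exact: (Fn n _ (nbhsx_ballx (l n) d d0)).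
  have [v [uv lv]] := filter_ex (filterI Fu Fd).
  move: uv lv; rewrite -!ball_normE/= => uv lv.
  rewrite -(subrKA (v n)); apply: (le_trans (ler_normD _ _)); apply: lerD.
    by apply: ltW; apply: le_lt_trans uv; exact: linf_coord_dist.
  by rewrite distrC ltW.
have [u0 Fu0] := Fb 1 ltr01.
have ll : l \in is_linf.
  apply/asboolP; exists (1 + linf_norm u0) => n.
  rewrite -[l n](subrK (u0 n)); apply: (le_trans (ler_normD _ _)).
  by apply: lerD; rewrite ?linf_norm_ub// distrC close.
apply/cvg_ex; exists (Linf ll); apply/cvgrPdist_le => e e0.
have e20 : 0 < e / 2 by rewrite divr_gt0.
have [u Fu] := Fb _ e20.
apply: filterS (Fu) => v; rewrite -ball_normE/= => uv.
apply: linf_norm_le => n; rewrite [X in `|X|](_ : _ = l n - v n)//.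
rewrite -(subrKA (u n)) (splitr e); apply: (le_trans (ler_normD _ _)).
apply: lerD; first by rewrite distrC close.
by apply: ltW; apply: le_lt_trans uv; exact: linf_coord_dist.
Qed.

HB.instance Definition _ := Uniform_isComplete.Build linf linf_complete.

End Linf.

Section WeakTopology.
Context {R : realType} (Z : normedModType R).

Definition weak_eval (z : Z) : {ptws (dual Z) -> R} := fun f => f z.

(* The carrier Z with the topology sigma(Z, Z'). *)
Definition weak := initial_topology weak_eval.
HB.instance Definition _ := Topological.on weak.

Definition weakly_null (z : nat -> Z) :=
  (z : nat -> weak) @ \oo --> ((0 : Z) : weak).

Lemma weakly_nullP (z : nat -> Z) :
  weakly_null z <-> forall f : dual Z, f (z n) @[n --> \oo] --> (0 : R).
Proof.
split=> [z0 f|z0].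
  have cf : continuous (fun x : weak => f x : R).
    move=> x; have fc := @proj_continuous (dual Z) (fun=> R) f (weak_eval x).
    exact: (cvg_comp _ _ (@initial_continuous _ _ weak_eval x) fc).
  have := cvg_comp _ _ z0 (cf 0).
  by rewrite /= linear0.
move=> A /= [B [[C oC <-] C0 CA]].
have zc :
    (fun n => weak_eval (z n)) @ \oo --> (weak_eval 0 : {ptws dual Z -> R}).
  have PF : Filter ((fun n => weak_eval (z n)) @ \oo) by exact: fmap_filter.
  apply: (pointwise_cvgP (weak_eval 0 : dual Z -> R) PF).2 => f.
  by rewrite /weak_eval linear0; exact: z0.
have CN : nbhs (weak_eval 0 : {ptws dual Z -> R}) C.
  by rewrite nbhsE; exists C.
change (\forall n \near \oo, A (z n)).
have Cz : \forall n \near \oo, C (weak_eval (z n)) := zc _ CN.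
by apply: (filterS _ Cz) => n Cn; exact: CA.
Qed.

Definition relatively_weakly_compact (A : set Z) := precompact (A : set weak).

End WeakTopology.

Section DunfordPettis.
Context {R : realType}.

(* In the two definitions below the sups are over norm bounded sets of reals;
   sup set0 = 0 is the right value when A is empty. *)
Definition DP_set (X : normedModType R) (A : set X) :=
  bounded_set A /\
  forall f : nat -> dual X, weakly_null f ->
    sup [set `|f n x| | x in A] @[n --> \oo] --> (0 : R).

Definition LDP_set (X : normedModType R) (A : set (dual X)) :=
  bounded_set A /\
  forall x : nat -> X, weakly_null x -> DP_set (range x) ->
    sup [set `|f (x n)| | f in A] @[n --> \oo] --> (0 : R).

Definition LDP_property (X : normedModType R) :=
  forall A : set (dual X), LDP_set A -> relatively_weakly_compact A.

Definition weakly_compact (X Y : normedModType R) (T : oper X Y) :=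
  relatively_weakly_compact (T @` [set x | `|x| <= 1]).

Definition is_DPcc (X Y : normedModType R) : {pred oper X Y} :=
  [pred T : oper X Y | `[< forall x : nat -> X,
    weakly_null x -> DP_set (range x) -> T (x n) @[n --> \oo] --> (0 : Y) >]].

End DunfordPettis.
Arguments is_DPcc {R} X Y.

Section DPccSpace.
Context {R : realType} (X Y : normedModType R).

Record DPcc := MkDPcc { DPcc_oper :> oper X Y; _ : DPcc_oper \in is_DPcc X Y }.

HB.instance Definition _ := [isSub for DPcc_oper].
HB.instance Definition _ := [Choice of DPcc by <:].

Lemma is_DPcc_submod : submod_closed (is_DPcc X Y).
Proof.
split; first by apply/asboolP => x _ _; exact: cvg_cst.
move=> a S T /asboolP HS /asboolP HT; apply/asboolP => x x0 xDP.
have -> : 0 = a *: 0 + 0 :> Y by rewrite scaler0 addr0.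
apply: (@cvgD _ _ _ _ _ (fun n => a *: S (x n)) (fun n => T (x n))).
  by apply: cvgZl_tmp; exact: HS.
exact: HT.
Qed.

HB.instance Definition _ :=
  GRing.isSubmodClosed.Build _ _ (is_DPcc X Y) is_DPcc_submod.
HB.instance Definition _ := [SubChoice_isSubLmodule of DPcc by <:].

Definition DPcc_norm (T : DPcc) : R := `|DPcc_oper T|.

Lemma ler_DPcc_normD S T : DPcc_norm (S + T) <= DPcc_norm S + DPcc_norm T.
Proof. exact: ler_normD. Qed.

Lemma DPcc_normZ (a : R) T : DPcc_norm (a *: T) = `|a| * DPcc_norm T.
Proof. exact: normrZ. Qed.

Lemma DPcc_norm0_eq0 T : DPcc_norm T = 0 -> T = 0.
Proof. by move=> T0; apply/val_inj/normr0_eq0. Qed.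

HB.instance Definition _ :=
  Lmodule_isNormed.Build R DPcc ler_DPcc_normD DPcc_normZ DPcc_norm0_eq0.

End DPccSpace.

(* Weakly compact operators are DPcc, so this is all of W(X, Y), seen inside
   DPcc(X, Y). *)
Definition W {R : realType} (X Y : normedModType R) : set (DPcc X Y) :=
  [set T | weakly_compact T].
Arguments W {R} X Y.

Definition complemented {R : realType} (Z : normedModType R) (Z1 : set Z) :=
  exists P : oper Z Z, (forall z, P (P z) = P z) /\ range P = Z1.

(* Main.v *)
From HB Require Import structures.
Require Import Defs.
From mathcomp Require Import all_boot all_order all_algebra.
From mathcomp Require Import all_classical all_reals.
From mathcomp Require Import topology normedtype sequences.
From mathcomp Require Import ring lra.

(** Let [A] be an L-Dunford-Pettis set of the dual of [X] which is not
    relatively weakly compact, and suppose that [P] projects DPcc(X, l^oo)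
    onto W(X, l^oo).

    Failure of weak compactness is put in the form of a double limit
    ([triangular_sequences]): there are [f_n] in [A], [x_m] in the unit ball of
    [X] and reals [r < s] with [f_n(x_m) > s] for [n <= m] and [f_n(x_m) < r]
    for [m < n].  Indeed some ultrafilter on the weak closure of [A] has no weak
    limit; its pointwise limit on the bidual differs, at some [G], from the
    value of [G] at the functional [f0] that it induces on [X], and the
    sequences are built one step at a time from this gap, the [f_n] from the
    ultrafilter and the [x_m] from Helly's theorem ([helly]).  This triangular
    pattern is inherited by all subsequences of [f_n].

    For [b] in l^oo, the diagonal operator [D b : x |-> (b_n f_n(x))_n] is DPcc
    because [A] is an L-Dunford-Pettis set, and it has rank one, hence is weakly
    compact and fixed by [P], when [b] is a unit vector.  The countably many
    functionals [b |-> ((D b - P (D b)) x_m)_k] thus vanish on the unit vectors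
    of l^oo.  A bounded functional with this property can be nonzero on the
    indicators of only countably many members of an almost disjoint family,
    while there is an uncountable almost disjoint family of infinite subsets of
    the integers; so all these functionals vanish at the indicator of one
    infinite set [M] ([vanish_on_infinite_indic]).

    Therefore the weakly compact operator [P (D 1_M)] agrees with [D 1_M] at
    every [x_m].  The coordinates of [D 1_M x_m] with index in [M] are the
    [f_n(x_m)], and their triangular pattern is incompatible with the existence
    of a weak cluster point of the sequence [P (D 1_M) x_m]
    ([weakly_compact_double_limit]): compare the coordinate functionals with
    their limit along an ultrafilter. *)

Set Implicit Arguments.
Unset Strict Implicit.
Unset Printing Implicit Defensive.

Import Order.TTheory GRing.Theory Num.Theory.
Import numFieldNormedType.Exports.

Local Open Scope classical_set_scope.
Local Open Scope ring_scope.

(** * Limits along ultrafilters *)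

Lemma ultra_cvg_bounded {R : realType} (T : Type) (F : set_system T)
    (u : T -> R) (M : R) :
  UltraFilter F -> (\forall t \near F, `|u t| <= M) -> cvg (u @ F).
Proof.
move=> UF uM.
have UuF : UltraFilter (u @ F).
  split=> [|G PG sG]; first exact: fmap_proper_filter.
  apply/seteqP; split=> // B GB.
  have [|] := in_ultra_setVsetC (u @^-1` B) UF; first by [].
  move=> FnB; have : G (~` B) by apply: sG.
  by move=> /(filterI GB); rewrite setICr => /filter_ex[].
have := @segment_compact R (- M) M; rewrite compact_ultra => /(_ _ UuF) [].
  by apply: filterS uM => t /=; rewrite in_itv/= ler_norml.
by move=> l [_ ul]; apply/cvg_ex; exists l.
Qed.

(** * The weak topology *)

Section Weak.
Context {R : realType} (Z : normedModType R).

Lemma weak_continuous (f : dual Z) : continuous (f : weak Z -> R).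
Proof.
move=> x; have fc := @proj_continuous (dual Z) (fun=> R) f (weak_eval x).
exact: (cvg_comp _ _ (@initial_continuous _ _ (@weak_eval R Z) x) fc).
Qed.

Lemma weak_cvg (F : set_system (weak Z)) (z : Z) : Filter F ->
  (forall f : dual Z, (f : weak Z -> R) @ F --> f z) -> F --> (z : weak Z).
Proof.
move=> FF zf A /= [B [[C oC <-] Cz CA]].
have PF : Filter ((fun y : weak Z => weak_eval y) @ F) by exact: fmap_filter.
have zc : (fun y : weak Z => weak_eval y) @ F
    --> (weak_eval z : {ptws dual Z -> R}).
  by apply: (pointwise_cvgP (weak_eval z : dual Z -> R) PF).2 => f; exact: zf.
have CN : nbhs (weak_eval z : {ptws dual Z -> R}) C by rewrite nbhsE; exists C.
have Cn : \forall y \near F, C (weak_eval y) := zc _ CN.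
by apply: (filterS _ Cn) => y Cy; exact: CA.
Qed.

Lemma open_weak_gt (f : dual Z) (a : R) :
  open ([set z | a < f z] : set (weak Z)).
Proof.
have /continuousP/(_ [set t | a < t]) := @weak_continuous f.
by apply; exact: open_gt.
Qed.

Lemma open_weak_lt (f : dual Z) (a : R) :
  open ([set z | f z < a] : set (weak Z)).
Proof.
have /continuousP/(_ [set t | t < a]) := @weak_continuous f.
by apply; exact: open_lt.
Qed.

Lemma weak_closure_norm_le (A : set (weak Z)) (g : dual Z) (c : R) :
  (forall z, A z -> `|g z| <= c) -> forall z, closure A z -> `|g z| <= c.
Proof.
move=> gc z Az; rewrite leNgt; apply/negP; rewrite lter_normr => /orP[cg|cg].
- have [w [/gc + /= cw]] := Az _ (open_nbhs_nbhs (conj (open_weak_gt g c) cg)).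
  by move=> /(le_trans (ler_norm _)); rewrite leNgt cw.
- rewrite ltrNr in cg.
  have [w [/gc + /= cw]] :=
    Az _ (open_nbhs_nbhs (conj (open_weak_lt g (- c)) cg)).
  by rewrite ler_norml => /andP[+ _]; rewrite leNgt cw.
Qed.

End Weak.

(** * Bounded linear operators from an explicit bound *)

Section MkOper.
Context {R : realType} (X Y : normedModType R).

Lemma is_operP (f : X -> Y) (M : R) :
  linear f -> (forall x, `|f x| <= M * `|x|) -> f \in @is_oper R X Y.
Proof.
move=> lf fM; apply/asboolP; split=> //.
pose L : {linear X -> Y} := HB.pack f (GRing.isLinear.Build R X Y _ f lf).
apply: (@linear_bounded_continuous _ _ _ L).1.
apply/linear_boundedP; exists `|M|; split; first exact: num_real.
move=> r Mr x; apply: (le_trans (fM x)); apply: ler_wpM2r => //.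
by apply: ltW; apply: le_lt_trans Mr; exact: ler_norm.
Qed.

(** The operator with underlying linear map [f], bounded by [M]. *)
Definition mkoper (f : X -> Y) (M : R) (lf : linear f)
  (fM : forall x, `|f x| <= M * `|x|) : oper X Y := Oper (is_operP lf fM).

End MkOper.

Section Composition.
Context {R : realType} (X Y Z : normedModType R).

Lemma comp_linear (g : oper Y Z) (f : oper X Y) : linear (fun x => g (f x)).
Proof. by move=> a x y; rewrite !linearP. Qed.

Lemma comp_bounded (g : oper Y Z) (f : oper X Y) x :
  `|g (f x)| <= opnorm g * opnorm f * `|x|.
Proof.
apply: (le_trans (opnormP _ _)); rewrite -mulrA.
by apply: ler_wpM2l (opnorm_ge0 _) _ _ (opnormP _ _).
Qed.

(** Composition of bounded operators. *)
Definition comp_oper (g : oper Y Z) (f : oper X Y) : oper X Z :=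
  mkoper (comp_linear g f) (comp_bounded g f).

End Composition.

(** * Helly's theorem *)

Section Helly.
Context {R : realType} (X : normedModType R).
Implicit Types (L : seq (dual X)) (G : dual (dual X)) (x v w : X).

Lemma dual_sumE (I : Type) (s : seq I) (F : I -> dual X) x :
  (\sum_(i <- s) F i) x = \sum_(i <- s) F i x.
Proof. by elim/big_rec2 : _ => // i y1 y2 _ <-. Qed.

(** The sum of squares [q x] measures how far [x] is from representing [G] on
    [L].  If its infimum over the ball were positive, an almost minimizer [v]
    would give coefficients [G h - h v], hence a functional [h0] separating
    [G] strictly from the ball, which contradicts [`|G| <= 1]. *)
Lemma helly_sqr L G (d : R) : `|G| <= 1 -> 0 < d ->
  exists2 x, `|x| <= 1 & \sum_(h <- L) (G h - h x) ^+ 2 < d.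
Proof.
move=> G1 d0; apply: contrapT => nox.
pose q x := \sum_(h <- L) (G h - h x : R) ^+ 2.
have qd x : `|x| <= 1 -> d <= q x.
  by move=> x1; rewrite leNgt; apply/negP => ?; apply: nox; exists x.
pose D := \sum_(h <- L) (2 * `|h|) ^+ 2.
have D0 : 0 <= D by apply: sumr_ge0 => h _; exact: sqr_ge0.
have DP v w : `|v| <= 1 -> `|w| <= 1 ->
    \sum_(h <- L) (h w - h v : R) ^+ 2 <= D.
  move=> v1 w1; apply: ler_sum => h _.
  rewrite -real_normK ?num_real// ler_sqr ?nnegrE ?mulr_ge0//.
  apply: (le_trans (ler_normB _ _)).
  have hv : `|h v| <= `|h| := opnorm_ub h v1.
  have hw : `|h w| <= `|h| := opnorm_ub h w1.
  by rewrite mulr2n mulrDl mul1r lerD.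
pose Q := [set q x | x in [set x | `|x| <= 1]].
have Qinf : has_inf Q.
  split; first by exists (q 0), 0 => //=; rewrite normr0.
  by exists d => _ [x x1 <-]; exact: qd.
have dQ : d <= inf Q.
  by apply: lb_le_inf => [|_ [x x1 <-]]; [exact: Qinf.1|exact: qd].
have [t [t0 t1 tE]] : exists t : R, [/\ 0 < t, t <= 1 & t * (1 + D) < d].
  exists (d / (1 + D + d)); split; first by rewrite divr_gt0//; lra.
    by rewrite ler_pdivrMr; lra.
  by rewrite mulrAC ltr_pdivrMr; [nra|lra].
have [_ [v v1 <-] qv] := inf_adherent (exprn_gt0 2 t0) Qinf.
pose h0 : dual X := \sum_(h <- L) ((G h - h v : R) *: h).
have h0E x : h0 x = \sum_(h <- L) (G h - h v : R) * h x.
  by rewrite dual_sumE.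
(* First-order condition at [v]: [q] at [v + t *: (w - v)] is at least the
   infimum, which is more than [q v - t ^+ 2]. *)
have step w : `|w| <= 1 -> h0 w <= h0 v + t * (1 + D) / 2.
  move=> w1.
  have z1 : `|v + t *: (w - v)| <= 1.
    have -> : v + t *: (w - v) = (1 - t) *: v + t *: w.
      by rewrite scalerBr scalerBl scale1r addrCA addrC.
    apply: (le_trans (ler_normD _ _)); rewrite !normrZ.
    rewrite (@ger0_norm _ t) ?(@ger0_norm _ (1 - t)); [|lra|exact: ltW].
    by move: v1 => /= v1; nra.
  have : inf Q <= q (v + t *: (w - v)).
    by apply: ge_inf; [exact: Qinf.2|exists (v + t *: (w - v))].
  have -> : q (v + t *: (w - v)) = q v - 2 * t * (h0 w - h0 v)
      + t ^+ 2 * \sum_(h <- L) (h w - h v : R) ^+ 2.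
    rewrite !h0E -sumrB !mulr_sumr -sumrB -big_split/=.
    apply: eq_bigr => h _; rewrite linearD linearZ linearB/=.
    by rewrite /GRing.scale/=; ring.
  have := DP v w v1 w1.
  set E := \sum_(h <- L) (h w - h v : R) ^+ 2 => ED.
  set a : R := h0 w; set b : R := h0 v.
  move=> H.
  have : 2 * t * (a - b) <= t * (t * (1 + D)) by nra.
  nra.
have h0n : `|h0| <= h0 v + t * (1 + D) / 2.
  apply: opnorm_le => w w1; rewrite ler_norml step// andbT lerNl.
  by rewrite -linearN step// normrN.
have Gh0 : G h0 = q v + h0 v.
  rewrite linear_sum h0E -big_split/=; apply: eq_bigr => h _.
  by rewrite linearZ/= /GRing.scale/=; ring.
have : G h0 <= `|h0|.
  apply: (le_trans (ler_norm _)); apply: (le_trans (opnormP _ _)).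
  by rewrite ler_piMl.
by rewrite Gh0; have := qd v v1; nra.
Qed.

(** Helly's theorem: on finitely many functionals, a bidual element of norm at
    most 1 is approximated by evaluation at points of the unit ball. *)
Lemma helly L G (e : R) : `|G| <= 1 -> 0 < e ->
  exists2 x, `|x| <= 1 & forall h, h \in L -> `|G h - h x| < e.
Proof.
move=> G1 e0; have [x x1 xe] := helly_sqr L G1 (exprn_gt0 2 e0).
exists x => // h hL.
rewrite -ltr_sqr ?nnegrE ?normr_ge0 ?ltW// real_normK ?num_real//.
apply: le_lt_trans xe; rewrite (big_rem h hL)/= lerDl.
by apply: sumr_ge0 => k _; exact: sqr_ge0.
Qed.

End Helly.

(** * Triangular sequences *)

Lemma bounded_set_norm_le (R : realType) (Z : normedModType R) (A : set Z) :
  bounded_set A -> exists2 K : R, 0 <= K & forall z, A z -> `|z| <= K.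
Proof.
move=> [K [_ AK]]; exists `|K + 1| => // z Az.
by apply: le_trans (ler_norm _); apply: (AK (K + 1) _ z Az); rewrite ltrDl.
Qed.

(** Construction of a sequence in which each term is related by [Q] to all the
    previous ones. *)
Lemma exists_sequence (T : eqType) (P : T -> Prop) (Q : T -> T -> Prop) :
  (forall l : seq T, (forall t, t \in l -> P t) ->
    exists t, P t /\ forall t', t' \in l -> Q t t') ->
  exists u : nat -> T, (forall n, P (u n)) /\
    forall m n, (m < n)%N -> Q (u n) (u m).
Proof.
move=> H.
have /choice[nxt nxtP] : forall l : seq T, exists t,
  (forall t, t \in l -> P t) -> P t /\ forall t', t' \in l -> Q t t'.
  move=> l; have [/H[t ?]|nl] := pselect (forall t, t \in l -> P t).
    by exists t.
  by have [t _] := H [::] (fun t ht => ltac:(by [])); exists t.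
(* The history of the terms already chosen, latest first. *)
pose fix hist n := if n is n'.+1 then nxt (hist n') :: hist n' else [::].
have hP n : forall t, t \in hist n -> P t.
  elim: n => [//|n IH] t /=; rewrite inE => /predU1P[->|]; last exact: IH.
  by have [] := nxtP _ IH.
have hI m n : (m < n)%N -> nxt (hist m) \in hist n.
  elim: n => [//|n IH]; rewrite ltnS leq_eqVlt inE => /predU1P[->|/IH ->].
    by rewrite eqxx.
  by rewrite orbT.
exists (fun n => nxt (hist n)); split=> [n|m n mn].
  by have [] := nxtP _ (@hP n).
by have [_] := nxtP _ (@hP n); apply; exact: hI.
Qed.

Section Triangle.
Context {R : realType} (X : normedModType R).

Lemma eval_bounded (x : X) (f : dual X) : `|(f x : R^o)| <= `|x| * `|f|.
Proof. by rewrite mulrC; exact: opnormP. Qed.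

(** The canonical embedding of [X] in its bidual. *)
Definition bidual_eval (x : X) : dual (dual X) :=
  @mkoper R (dual X) R^o (fun f => f x) `|x| (fun a f g => erefl)
    (eval_bounded x).

(** The half of Grothendieck's double limit criterion used here: a bounded set
    of functionals that is not relatively weakly compact contains a sequence
    whose values on some sequence of the unit ball have a triangular gap. *)
Lemma triangular_sequences (A : set (dual X)) :
  bounded_set A -> ~ relatively_weakly_compact A ->
  exists (f : nat -> dual X) (x : nat -> X) (r s : R),
    [/\ r < s, forall n, A (f n), forall n, `|x n| <= 1,
        forall n m, (n <= m)%N -> s < f n (x m) &
        forall n m, (m < n)%N -> f n (x m) < r].
Proof.
move=> bA nA; apply: contrapT => noseq; apply: nA.
rewrite /relatively_weakly_compact precompactE compact_ultra => F UF FA.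
have FF : ProperFilter F by exact: ultra_proper.
have [K K0 AK] := bounded_set_norm_le bA.
have GK (G : dual (dual X)) f :
    closure (A : set (weak (dual X))) f -> `|G f| <= `|G| * K.
  apply: weak_closure_norm_le => g /AK gK.
  by apply: (le_trans (opnormP G g)); exact: ler_wpM2l (opnorm_ge0 G) _ _ gK.
have Gcvg (G : dual (dual X)) : cvg ((G : weak (dual X) -> R) @ F).
  by apply: ultra_cvg_bounded; apply: filterS FA => f; exact: GK.
pose Phi (G : dual (dual X)) : R := lim ((G : weak (dual X) -> R) @ F).
have PhiE (G : dual (dual X)) : (G : weak (dual X) -> R) @ F --> Phi G.
  exact: Gcvg.
pose phi x : R^o := Phi (bidual_eval x).
have phi_lin : linear phi.
  move=> a x y; apply/cvg_lim => //.
  have -> : (bidual_eval (a *: x + y) : weak (dual X) -> R) =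
      (fun f => a * bidual_eval x f + bidual_eval y f).
    by apply/funext => f; rewrite /= linearP.
  apply: cvgD; last exact: PhiE.
  by apply: cvgMl_tmp; exact: PhiE.
have phi_bd x : `|phi x| <= K * `|x|.
  have := PhiE (bidual_eval x) => /cvg_norm PhiN.
  apply: (cvgr_to_le PhiN); apply: filterS FA => f /(GK (bidual_eval x)) fK.
  apply: (le_trans fK); rewrite mulrC ler_wpM2l//.
  by apply: opnorm_le => g g1; rewrite /= (le_trans (opnormP _ _))// ler_piMl.
pose f0 : dual X := mkoper phi_lin phi_bd.
(* It is enough that [Phi G <= G f0] on the unit ball: then [F] converges
   weakly to [f0]. *)
suff key (G : dual (dual X)) : `|G| <= 1 -> Phi G <= G f0.
  have PhiZ (c : R) (G : dual (dual X)) : Phi (c *: G) = c * Phi G.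
    apply/cvg_lim => //.
    by apply: (@cvgMl_tmp _ _ F _ (G : weak (dual X) -> R)); exact: PhiE.
  have le (G : dual (dual X)) : Phi G <= G f0.
    pose c : R := (`|G| + 1)^-1.
    have c0 : 0 < c by rewrite invr_gt0 ltr_wpDl.
    have := key (c *: G); rewrite PhiZ.
    have -> : (c *: G) f0 = c * G f0 by [].
    rewrite ler_pM2l//; apply; rewrite normrZ gtr0_norm//.
    by rewrite ler_pdivrMl ?ltr_wpDl// mulr1 lerDl.
  exists f0.
  have Ff0 : F --> (f0 : weak (dual X)).
    apply: weak_cvg => G; have -> : G f0 = Phi G; last exact: PhiE.
    apply/eqP; rewrite eq_le le andbT -lerN2.
    have := le (- 1 *: G); rewrite PhiZ mulN1r.
    by have -> : (- 1 *: G) f0 = - G f0 by rewrite scaleN1r.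
  split=> //; apply: (@closed_closure (weak (dual X)) A) => B /Ff0 FB.
  exact: filter_ex (filterI FA FB).
move=> G1; rewrite leNgt; apply/negP => lt; apply: noseq.
(* Four steps [d] lead from [G f0] to [Phi G]: [r] and [s] lie in between, and
   one step is kept for the approximation errors. *)
pose d := (Phi G - G f0) / 4.
have d0 : 0 < d by rewrite divr_gt0 ?subr_gt0.
have PhiGE : Phi G = G f0 + 4 * d by rewrite /d; field.
pose r := G f0 + d; pose s := G f0 + 2 * d.
(* The conditions on [f0] and [G] concern one pair only, and they allow
   later pairs to be chosen against it. *)
pose P (p : dual X * X) :=
  [/\ A p.1, s + d < G p.1, `|p.2| <= 1, f0 p.2 < r & s < p.1 p.2].
pose Q (p q : dual X * X) := p.1 q.2 < r /\ s < q.1 p.2.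
have [|u [uP uQ]] := @exists_sequence _ P Q.
  move=> l lP.
  have [f [Af fs fr]] : exists f, [/\ A f, s + d < G f &
      forall p, p \in l -> f p.2 < r].
    have : exists O : set (weak (dual X)), [/\ open O, F O &
        forall f, O f -> s + d < G f /\ forall p, p \in l -> f p.2 < r].
      elim: l lP => [_|p l IH lP].
        exists [set f | s + d < G f]; split=> //; first exact: open_weak_gt.
        by apply: (cvgr_gt _ (PhiE G)); rewrite /s PhiGE; lra.
      have [|O [oO FO OP]] := IH.
        by move=> q ql; apply: lP; rewrite inE ql orbT.
      have [_ _ _ pr _] := lP p (mem_head _ _).
      exists (O `&` [set f | bidual_eval p.2 f < r]); split.
      + by apply: openI => //; exact: open_weak_lt.
      + by apply: filterI => //; exact: (cvgr_lt _ (PhiE (bidual_eval p.2))).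
      + move=> f [/OP[fs fr] fp]; split=> // q.
        by rewrite inE => /predU1P[->|/fr].
    move=> [O [oO FO OP]].
    have [g [Og Ag]] := filter_ex (filterI FO FA).
    have [f [Af /OP[fs fr]]] := Ag _ (open_nbhs_nbhs (conj oO Og)).
    by exists f.
  have [x x1 xL] := helly [:: f0, f & map fst l] G1 d0.
  have xf0 : f0 x < r.
    have := xL f0 (mem_head _ _); rewrite ltr_norml => /andP[+ _].
    by rewrite /r; lra.
  have xs g : g \in f :: map fst l -> s + d < G g -> s < g x.
    move=> gl sg; have := xL g; rewrite inE gl orbT => /(_ isT).
    by rewrite ltr_norml => /andP[_]; lra.
  exists (f, x); split; first by split=> //; apply: xs fs; exact: mem_head.
  move=> p pl; split; first exact: fr.
  have [_ ps _ _ _] := lP p pl.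
  by apply: xs ps; rewrite inE map_f ?orbT.
exists (fst \o u), (snd \o u), r, s; split.
- by rewrite /r /s; lra.
- by move=> n; have [] := uP n.
- by move=> n; have [] := uP n.
- move=> n m; rewrite leq_eqVlt => /predU1P[->|nm]; first by have [] := uP m.
  by have [] := uQ n m nm.
- by move=> n m mn; have [] := uQ m n mn.
Qed.

End Triangle.

(** * The space l^oo *)

Section Linf.
Context {R : realType}.

Lemma linf_mem (u : nat -> R) (M : R) : (forall n, `|u n| <= M) ->
  u \in @is_linf R.
Proof. by move=> uM; apply/asboolP; exists M. Qed.

(** The element of l^oo with underlying sequence [u], bounded by [M]. *)
Definition mklinf (u : nat -> R) (M : R) (uM : forall n, `|u n| <= M) :
  linf R := Linf (linf_mem uM).

Lemma indic_norm_le1 (A : set nat) n : `|(n \in A)%:R : R| <= 1.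
Proof. by case: (_ \in _); rewrite ?normr1 ?normr0. Qed.

(** The indicator of a set of integers, as an element of l^oo; those of the
    singletons are the unit vectors. *)
Definition linf_indic (A : set nat) : linf R := mklinf (indic_norm_le1 A).

Lemma linf_sumE (I : Type) (s : seq I) (P : pred I) (F : I -> linf R) n :
  (\sum_(i <- s | P i) F i) n = \sum_(i <- s | P i) F i n.
Proof. by elim/big_rec2 : _ => // i y1 y2 _ <-. Qed.

Lemma coord_le (u : linf R) n : `|(u n : R^o)| <= 1 * `|u|.
Proof. by rewrite mul1r; exact: linf_norm_ub. Qed.

(** The coordinate functionals of l^oo. *)
Definition linf_coord (n : nat) : dual (linf R) :=
  @mkoper R (linf R) R^o (fun u => u n) 1 (fun a u v => erefl)
    (fun u => coord_le u n).

Lemma finite_support_sum (u : linf R) (N : nat) :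
  (forall n, (N <= n)%N -> u n = 0) ->
  u = \sum_(k < N) u k *: linf_indic [set nat_of_ord k].
Proof.
move=> u0; apply/val_inj/funext => n /=; rewrite linf_sumE.
have E k : (u k *: linf_indic [set k]) n = u k * (n == k)%:R.
  change (u k * (n \in [set k])%:R = u k * (n == k)%:R).
  by congr (_ * _%:R); congr nat_of_bool; apply/idP/eqP; rewrite inE.
under eq_bigr do rewrite E.
have [nN|Nn] := ltnP n N.
  rewrite (bigD1 (Ordinal nN))//= eqxx mulr1 big1 ?addr0// => k kn.
  by rewrite -(inj_eq val_inj)/= eq_sym in kn; rewrite (negPf kn) mulr0.
rewrite u0// big1// => k _; rewrite gtn_eqF ?mulr0//.
exact: leq_trans (ltn_ord k) Nn.
Qed.

(** * Functionals on l^oo that vanish on the unit vectors *)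

Section Vanishing.
Variable mu : dual (linf R).
Hypothesis mu0 : forall n, mu (linf_indic [set n]) = 0.

Lemma vanish_finite_support (u : linf R) (N : nat) :
  (forall n, (N <= n)%N -> u n = 0) -> mu u = 0.
Proof.
move=> /finite_support_sum ->; rewrite linear_sum big1// => k _.
by rewrite linearZ/= mu0 scaler0.
Qed.

(** Setting finitely many coordinates of [u] to 0 does not change [mu u]. *)
Lemma le_opnorm_eventually (u : linf R) (N : nat) :
  (forall n, (N <= n)%N -> `|u n| <= 1) -> `|mu u| <= `|mu|.
Proof.
move=> u1.
have vP n : `|if (n < N)%N then 0 else u n| <= 1.
  by case: ltnP => [_|/u1//]; rewrite normr0.
pose v := mklinf vP.
have -> : mu u = mu v.
  apply/eqP; rewrite -subr_eq0 -linearB; apply/eqP.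
  apply: (@vanish_finite_support _ N) => n Nn.
  change (u n - (if (n < N)%N then 0 else u n) = 0).
  by rewrite ltnNge Nn/= subrr.
by apply: opnorm_ub; exact: linf_norm_le.
Qed.

(** On an infinite sequence of almost disjoint sets, the values of [mu] at the
    indicators are not bounded away from 0: with suitable signs, a sum of [N] of
    these indicators is at most 1 in absolute value outside a finite set, so
    that [N * e] would be at most the norm of [mu] for all [N]. *)
Lemma almost_disjoint_values (M : nat -> set nat) (b : nat -> nat -> nat)
    (e : R) :
  (forall i j n, i != j -> M i n -> M j n -> (n < b i j)%N) ->
  0 < e -> ~ (forall i, e <= `|mu (linf_indic (M i))|).
Proof.
move=> Mb e0 Me.
have bound (N : nat) : N%:R * e <= `|mu|.
  pose c i := mu (linf_indic (M i)) : R.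
  pose u : linf R := \sum_(i < N) Num.sg (c i) *: linf_indic (M i).
  pose B := (\max_(i < N) \max_(j < N) b i j)%N.
  have muE : mu u = \sum_(i < N) `|c i|.
    rewrite linear_sum; apply: eq_bigr => i _.
    by rewrite linearZ/= [LHS]mulrC normrEsg mulrC.
  have -> : N%:R * e = \sum_(i < N) e by rewrite sumr_const card_ord mulr_natl.
  apply: (@le_trans _ _ (mu u)).
    by rewrite muE; apply: ler_sum => i _; exact: Me.
  apply: (le_trans (ler_norm _)); apply: (@le_opnorm_eventually _ B) => n Bn.
  have uE : u n = \sum_(i < N) Num.sg (c i) * (n \in M i)%:R.
    by rewrite linf_sumE.
  have [[i iM]|nM] := pselect (exists i : 'I_N, n \in M i); last first.
    rewrite uE big1 ?normr0// => i _.
    have [nMi|] := boolP (n \in M i); last by rewrite mulr0.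
    by case: nM; exists i.
  (* Beyond [B], the point [n] belongs to no other set of the family. *)
  rewrite uE (bigD1 i)//= big1 ?addr0 => [|j ji].
    rewrite iM mulr1 normr_sg; by case: (_ != _).
  have [/set_mem jM|] := boolP (n \in M j); last by rewrite mulr0.
  have := Mb _ _ _ ji jM (set_mem iM).
  rewrite ltnNge (leq_trans _ Bn)//.
  apply: leq_trans (@leq_bigmax _ (fun j : 'I_N => \max_(k < N) b j k)%N j).
  exact: (@leq_bigmax _ (fun i : 'I_N => b j i) i).
have := bound (Num.truncn (`|mu| / e)).+1.
by rewrite -ler_pdivlMr// leNgt Num.Theory.truncnS_gt.
Qed.

End Vanishing.

(** The codes of the finite prefixes of an infinite binary sequence.  The ranges
    of these functions form an uncountable almost disjoint family of infinite
    sets of integers. *)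
Definition branch (a : nat -> bool) (n : nat) : nat :=
  choice.pickle (mkseq a n).

Lemma branch_inj a : injective (branch a).
Proof.
move=> m n /(pcan_inj choice.pickleK) /(congr1 size).
by rewrite !size_mkseq.
Qed.

Lemma branch_almost_disjoint a a' : a <> a' -> exists b, forall n,
  range (branch a) n -> range (branch a') n -> (n < b)%N.
Proof.
move=> aa'.
have [k ak] : exists k, a k != a' k.
  apply: contrapT => H; apply: aa'; apply/funext => k; apply/eqP/negPn/negP.
  by move=> ?; apply: H; exists k.
exists (\max_(i < k.+1) branch a i).+1 => _ [i _ <-] [j _] ij.
have /(pcan_inj choice.pickleK) E := ij.
have ji : j = i by have := congr1 size E; rewrite !size_mkseq.
rewrite ji in E; rewrite ltnS.
have ik : (i < k.+1)%N.
  rewrite ltnS leqNgt; apply/negP => ki; move/negP: ak; apply.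
  by have := congr1 (nth false ^~ k) E; rewrite !nth_mkseq// => ->.
exact: (@leq_bigmax _ (fun i : 'I_k.+1 => branch a i) (Ordinal ik)).
Qed.

Lemma uncountable_branches : ~ countable [set: nat -> bool].
Proof.
move=> /countable_injP[f /in2TT finj].
(* Cantor's diagonal argument; [d] is evaluated at its own code. *)
pose d n := `[< exists2 a, f a = n & ~~ a n >].
have : d (f d) <-> ~~ d (f d).
  split=> [/asboolP[a /finj -> //]|dfd].
  by apply/asboolP; exists d.
by case: (d (f d)) => -[] // h1 h2; [have := h1 isT|have := h2 isT].
Qed.

(** For each functional and each [e > 0], only finitely many branches have an
    indicator on which the functional is at least [e] in absolute value;
    uncountability leaves a branch that is good for all functionals. *)
Lemma vanish_on_infinite_indic (I : countType) (mu : I -> dual (linf R)) :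
  (forall i n, mu i (linf_indic [set n]) = 0) ->
  exists2 g : nat -> nat, injective g &
    forall i, mu i (linf_indic (range g)) = 0.
Proof.
move=> mu0.
pose B (p : I * nat) : set (nat -> bool) :=
  [set a | p.2.+1%:R^-1 <= `|mu p.1 (linf_indic (range (branch a)))|].
have Bc p : countable (B p).
  apply: finite_set_countable; apply: contrapT => /infiniteP/pcard_leP[h].
  have hB i : B p (h i) by exact: funS.
  have hinj i j : i != j -> h i <> h j.
    by move=> /eqP ij /inj ij'; apply: ij; apply: ij'; rewrite inE.
  have /choice[b bP] : forall q : nat * nat, exists b, q.1 != q.2 -> forall n,
      range (branch (h q.1)) n -> range (branch (h q.2)) n -> (n < b)%N.
    move=> q; have [->|/hinj/branch_almost_disjoint[b bP]] := eqVneq q.1 q.2.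
      by exists 0%N.
    by exists b.
  apply: (@almost_disjoint_values (mu p.1) (mu0 p.1)
    (fun i => range (branch (h i))) (fun i j => b (i, j)) p.2.+1%:R^-1) => //.
    by move=> i j n /(bP (i, j)); exact.
  by rewrite invr_gt0 ltr0n.
have [a aB] : exists a, ~ (\bigcup_p B p) a.
  apply: contrapT => H; apply: uncountable_branches.
  have -> : [set: nat -> bool] = \bigcup_p B p.
    by apply/seteqP; split=> // a _; apply: contrapT => ?; apply: H; exists a.
  by apply: bigcup_countable.
exists (branch a); first exact: branch_inj.
move=> i; apply/eqP; rewrite -normr_le0; apply/ler_addgt0Pr => e e0.
rewrite add0r leNgt; apply/negP => emu; apply: aB.
exists (i, Num.truncn e^-1) => //; rewrite /B/=.
apply: le_trans (ltW emu); rewrite invf_ple ?posrE//.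
by apply/ltW; exact: Num.Theory.truncnS_gt.
Qed.

End Linf.

(** * The weak topology of l^oo *)

Section LinfWeak.
Context {R : realType}.

Lemma weak_linf_hausdorff : hausdorff_space (weak (linf R)).
Proof.
move=> p q pq; apply/val_inj/funext => n; apply/eqP; rewrite /= eq_le.
have aux (a b : linf R) : cluster (nbhs (a : weak (linf R))) b -> a n <= b n.
  move=> ab; rewrite leNgt; apply/negP => ba.
  pose c := (a n + b n) / 2.
  have ca : c < a n by rewrite /c; lra.
  have bc : b n < c by rewrite /c; lra.
  have [u [/= cu]] := ab _ _
    (open_nbhs_nbhs (conj (open_weak_gt (linf_coord n) c) ca))
    (open_nbhs_nbhs (conj (open_weak_lt (linf_coord n) c) bc)).
  by move=> /(lt_trans cu); rewrite ltxx.
by rewrite !aux// => A B ? ?; rewrite setIC; exact: pq.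
Qed.

Lemma weak_linf_line_compact (v : linf R) (K : R) :
  relatively_weakly_compact [set c *: v | c in `[- K, K]].
Proof.
apply: (compact_precompact weak_linf_hausdorff).
apply: (@continuous_compact _ _ (fun c : R => c *: v : weak (linf R)));
  last exact: segment_compact.
apply: continuous_subspaceT => c; apply: weak_cvg => f.
have -> : (f : weak (linf R) -> R) (c *: v) = c * f v by rewrite linearZ.
change ((fun d : R => f (d *: v) : R) @ c --> c * f v).
have -> : (fun d : R => f (d *: v) : R) = (fun d => d * f v).
  by apply/funext => d; rewrite linearZ.
exact: (@cvgMr_tmp R R (nbhs c) _ (fun x => x) c (f v) cvg_id).
Qed.

(** Along any sequence of coordinates there is a generalized limit, here the
    limit along a free ultrafilter. *)
Lemma limit_functional (g : nat -> nat) : exists L : dual (linf R),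
  forall (u : linf R) (a : R),
    ((\forall n \near \oo, u (g n) <= a) -> L u <= a) /\
    ((\forall n \near \oo, a <= u (g n)) -> a <= L u).
Proof.
have [V [UV oV]] := ultraFilterLemma (eventually_filter).
have VF : ProperFilter V by exact: ultra_proper.
have Vcvg (u : linf R) : cvg ((fun n => u (g n)) @ V).
  apply: (@ultra_cvg_bounded _ _ _ _ `|u|) => //.
  by apply: filterE => n; exact: linf_norm_ub.
pose L (u : linf R) : R^o := lim ((fun n => u (g n)) @ V).
have L_lin : linear L.
  move=> a u v; apply/cvg_lim => //.
  have -> : (fun n => (a *: u + v) (g n)) = (fun n => a * u (g n) + v (g n)).
    by [].
  by apply: cvgD; [apply: cvgMl_tmp|]; exact: Vcvg.
have L_bd u : `|L u| <= 1 * `|u|.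
  rewrite mul1r; apply: (cvgr_to_le (cvg_norm (Vcvg u))).
  by apply: filterE => n; exact: linf_norm_ub.
exists (mkoper L_lin L_bd) => u a; split => ua.
- by apply: (cvgr_to_le (Vcvg u)); exact: oV.
- by apply: (cvgr_to_ge (Vcvg u)); exact: oV.
Qed.

End LinfWeak.

(** * Diagonal operators *)

Section Diagonal.
Context {R : realType} (X : normedModType R).
Variables (A : set (dual X)) (LA : LDP_set A).
Variables (f : nat -> dual X) (fA : forall n, A (f n)).
Variables (K : R) (AK : forall h, A h -> `|h| <= K).

Let K0 : 0 <= K. Proof. exact: le_trans (AK (fA 0%N)). Qed.

Lemma diag_seq_le (b : linf R) (x : X) n :
  `|b n * f n x : R| <= `|b| * K * `|x|.
Proof.
rewrite normrM -mulrA; apply: ler_pM => //; first exact: linf_norm_ub.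
apply: (le_trans (opnormP _ _)); apply: ler_wpM2r => //; exact: AK.
Qed.

(** The diagonal map [x |-> (b_n f_n(x))_n] attached to [b]. *)
Definition diag_fun (b : linf R) (x : X) : linf R := mklinf (diag_seq_le b x).

Lemma diag_fun_linear b : linear (diag_fun b).
Proof.
move=> a x y; apply/val_inj/funext => n /=.
change (b n * f n (a *: x + y) = a * (b n * f n x) + b n * f n y).
have -> : f n (a *: x + y) = a * f n x + f n y :> R by rewrite linearP.
by rewrite mulrDr mulrCA.
Qed.

Lemma diag_fun_bounded b x : `|diag_fun b x| <= `|b| * K * `|x|.
Proof. by apply: linf_norm_le => n; exact: diag_seq_le. Qed.

(** The diagonal map of [b] as a bounded operator on [X]. *)
Definition diag_oper b : oper X (linf R) :=
  mkoper (diag_fun_linear b) (diag_fun_bounded b).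

Lemma diag_oper_DPcc b : diag_oper b \in is_DPcc X (linf R).
Proof.
apply/asboolP => x x0 xDP.
have [_ /(_ x x0 xDP) sup0] := LA.
apply/norm_cvg0P.
have bsup0 : (`|b| * sup [set `|h (x n)| | h in A]) @[n --> \oo] --> (0 : R).
  by rewrite -(mulr0 `|b|); apply: cvgMl_tmp.
apply: (squeeze_cvgr _ (@cvg_cst _ _ _ _ _) bsup0).
apply: filterE => n; rewrite normr_ge0/=; apply: linf_norm_le => m.
change (`|b m * f m (x n) : R| <= `|b| * sup [set `|h (x n)| | h in A]).
rewrite normrM; apply: ler_pM => //; first exact: linf_norm_ub.
apply: ub_le_sup; last by exists (f m).
exists (K * `|x n|) => _ [h Ah <-]; apply: (le_trans (opnormP _ _)).
by apply: ler_wpM2r => //; exact: AK.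
Qed.

(** The diagonal operator of [b] as an element of DPcc(X, l^oo). *)
Definition diag b : DPcc X (linf R) := MkDPcc (diag_oper_DPcc b).

Lemma diag_linear : linear diag.
Proof.
move=> a b c; apply/val_inj/val_inj/funext => x; apply/val_inj/funext => n /=.
change ((a * b n + c n) * f n x = a * (b n * f n x) + c n * f n x).
by rewrite mulrDl mulrA.
Qed.

Lemma diag_bounded b : `|diag b| <= K * `|b|.
Proof.
apply: opnorm_le => x x1; apply: (le_trans (diag_fun_bounded b x)).
by rewrite mulrC [K * _]mulrC ler_piMl// mulr_ge0.
Qed.

(** The bounded operator from l^oo to DPcc(X, l^oo) that maps [b] to the
    diagonal operator of [b]. *)
Definition diag_map : oper (linf R) (DPcc X (linf R)) :=
  mkoper diag_linear diag_bounded.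

Lemma diag_rank1 n : W X (linf R) (diag_map (linf_indic [set n])).
Proof.
apply: precompact_subset (weak_linf_line_compact (linf_indic [set n]) K).
move=> _ [x x1 <-]; exists (f n x : R).
  rewrite /= in_itv/= -ler_norml; apply: (le_trans (opnormP _ _)).
  by apply: (le_trans _ (AK (fA n))); exact: ler_piMr (opnorm_ge0 _) x1.
apply/val_inj/funext => k /=.
change ((f n x : R) * (k \in [set n])%:R = (k \in [set n])%:R * f k x).
have [/set_mem ->|] := boolP (k \in [set n]); first exact: mulrC.
by rewrite mulr0 mul0r.
Qed.

End Diagonal.

(** * Entries of operators with values in l^oo *)

Section Entry.
Context {R : realType} (X Z : normedModType R).
Variables (T : oper Z (DPcc X (linf R))) (x : X) (k : nat).

Lemma entry_linear : linear (fun z => T z x k : R^o).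
Proof. by move=> a z w; rewrite linearP. Qed.

Lemma entry_bounded z : `|(T z x k : R^o)| <= opnorm T * `|x| * `|z|.
Proof.
apply: (le_trans (linf_norm_ub (T z x) k)).
apply: (le_trans (opnormP (DPcc_oper (T z)) x)).
by rewrite mulrAC; apply: ler_wpM2r (normr_ge0 x) _ _ (opnormP T z).
Qed.

(** For an operator [T] with values in DPcc(X, l^oo), the functional that maps
    [z] to the [k]-th coordinate of [T z x]. *)
Definition entry : dual Z := mkoper entry_linear entry_bounded.

End Entry.

(** * Non-complementation *)

Lemma injective_eventually_gt (g : nat -> nat) (m : nat) :
  injective g -> \forall n \near \oo, (m < g n)%N.
Proof.
move=> ginj.
have ne k : \forall n \near \oo, g n != k.
  have [[n0 <-]|nk] := pselect (exists n, g n = k).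
    by exists n0.+1 => // n /= n0n; rewrite inj_eq// gtn_eqF.
  by apply: filterE => n; apply/eqP => gk; apply: nk; exists n.
elim: m => [|m IH]; first by apply: filterS (ne 0%N) => n; rewrite lt0n.
by apply: filterS2 IH (ne m.+1) => n mg nm; rewrite ltn_neqAle eq_sym nm.
Qed.

(** Let [y] be a weak cluster point of [T x_m].  Each coordinate [g n] of [y] is
    at least [s], hence so is the generalized limit of [y] along [g]; but the
    generalized limit of each [T x_m] along [g] is at most [r]. *)
Lemma weakly_compact_double_limit (R : realType) (X : normedModType R)
    (T : oper X (linf R)) (x : nat -> X) (g : nat -> nat) (r s : R) :
  injective g -> weakly_compact T -> (forall m, `|x m| <= 1) -> r < s ->
  (forall n m, (g n <= m)%N -> s < T (x m) (g n)) ->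
  (forall n m, (m < g n)%N -> T (x m) (g n) < r) -> False.
Proof.
move=> ginj; rewrite /weakly_compact /relatively_weakly_compact precompactE.
move=> Tc x1 rs lo up.
pose F : set_system (weak (linf R)) := (fun m => T (x m)) @ \oo.
have FT : F (closure (T @` [set x | `|x| <= 1] : set (weak (linf R)))).
  by exists 0%N => // m _; apply: subset_closure; exists (x m) => //; exact: x1.
have [y [_ yF]] := Tc F _ FT.
have ys n : s <= y (g n).
  rewrite leNgt; apply/negP => ys.
  have Flo : F [set u | s < u (g n)] by exists (g n) => // m /=; exact: lo.
  have [u [/= su us]] := yF _ _ Flo
    (open_nbhs_nbhs (conj (open_weak_lt (linf_coord (g n)) s) ys)).
  by move: us => /=; rewrite ltNge ltW.
have [L LP] := @limit_functional R g.
have Ly : r < L y.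
  by apply: (lt_le_trans rs); apply: (LP y s).2; exact: filterE.
have Fr : F [set u | L u <= r].
  exists 0%N => // m _; apply: (LP _ _).1.
  by apply: filterS (injective_eventually_gt m ginj) => n /up/ltW.
have [u [/= ur ru]] := yF _ _ Fr
  (open_nbhs_nbhs (conj (open_weak_gt L r) Ly)).
by move: ru => /=; rewrite ltNge ur.
Qed.

Theorem theorem2p13 (R : realType) (X : completeNormedModType R) :
  ~ LDP_property X -> ~ complemented (W X (linf R)).
Proof.
move=> nLDP [P [PP rP]]; apply: nLDP => A LA; apply: contrapT => nA.
have [bA _] := LA.
have [f [x [r [s [rs fA x1 lo up]]]]] := triangular_sequences bA nA.
have [K _ AK] := bounded_set_norm_le bA.
pose D := diag_map LA fA AK.
pose T := D - comp_oper P D.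
have TE b : T b = D b - P (D b) by [].
have PW z : W X (linf R) z -> P z = z by rewrite -rP => -[w _ <-]; exact: PP.
pose mu (p : nat * nat) := entry T (x p.1) p.2.
have [|g ginj gmu] := @vanish_on_infinite_indic R _ mu.
  move=> p n; change (T (linf_indic [set n]) (x p.1) p.2 = 0).
  by rewrite TE PW ?subrr//; exact: diag_rank1.
pose chi : linf R := linf_indic (range g).
have PDW : W X (linf R) (P (D chi)) by rewrite -rP; exists (D chi).
have PDE m n : P (D chi) (x m) (g n) = f (g n) (x m).
  have E : D chi (x m) (g n) - P (D chi) (x m) (g n) = 0 := gmu (m, g n).
  rewrite -(subr0_eq E).
  change ((g n \in range g)%:R * f (g n) (x m) = f (g n) (x m)).
  have -> : g n \in range g by apply/mem_set; exists n.
  exact: mul1r.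
apply: (weakly_compact_double_limit ginj PDW x1 rs) => n m nm; rewrite PDE.
  exact: lo.
exact: up.
Qed.
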